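(* Let $ABC$ be a nondegenerate triangle with $a=|BC|$, $b=|CA|$, $c=|AB|$, let $x,y,z$ be real numbers with $x+y+z\neq0$, let $P=(x+y+z)^{-1}[x,y,z]$, and let $Q$ be any point in the plane of $ABC$. Then $$(x+y+z)\left(x|QA|^2+y|QB|^2+z|QC|^2\right)-\left(yza^2+zxb^2+xyc^2\right)=(x+y+z)^2|PQ|^2\ \ge\ 0 .$$
   Context: Barycentric coordinates are taken with respect to triangle $ABC$ and normalized: $[u,v,w]$ with $u+v+w=1$ denotes the point $uA+vB+wC$ (affine combination of the vertices). *)

(* Defs.v *)
From mathcomp Require Import all_boot all_order all_algebra.
From mathcomp Require Import reals.

Set Implicit Arguments.
Unset Strict Implicit.
Unset Printing Implicit Defensive.

Import Order.TTheory GRing.Theory Num.Theory.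
Local Open Scope ring_scope.

Notation point R := 'rV[R]_2.

(* The norm that MathComp-Analysis puts on row vectors is the sup norm, hence
   the explicit Euclidean distance. *)
Definition edist (R : realType) (P Q : point R) : R :=
  Num.sqrt (\sum_(i < 2) (P 0 i - Q 0 i) ^+ 2).

Definition collinear (R : realType) (A B C : point R) : Prop :=
  exists p d : point R, d != 0 /\
    exists r s t : R, [/\ A = p + r *: d, B = p + s *: d & C = p + t *: d].

Definition nondegenerate_triangle (R : realType) (A B C : point R) : Prop :=
  ~ collinear A B C.

(* The point [u, v, w]; a normalized barycentric triple when u + v + w = 1. *)
Definition bary (R : realType) (A B C : point R) (u v w : R) : point R :=
  u *: A + v *: B + w *: C.

(* Main.v *)
Require Import Defs.
From mathcomp Require Import all_boot all_order all_algebra.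
From mathcomp Require Import reals.
From mathcomp Require Import ring.
Import Order.TTheory GRing.Theory Num.Theory.
Local Open Scope ring_scope.

(** With [s = x + y + z], the vector [s (P - Q)] equals [x (A - Q) + y (B - Q) + z (C - Q)].
    Squaring it and replacing each [2 (A - Q).(B - Q)] by [|QA|^2 + |QB|^2 - c^2] gives the
    identity. Since only squared distances occur, [edist_sqr] removes the roots and leaves a
    rational identity in coordinates. *)

Lemma edist_sqr (R : realType) (P Q : point R) :
  edist P Q ^+ 2 = \sum_(i < 2) (P 0 i - Q 0 i) ^+ 2.
Proof. by rewrite sqr_sqrtr // sumr_ge0 // => i _; rewrite sqr_ge0. Qed.

Theorem mainTheorem8 (R : realType) (A B C : point R)
    (hABC : nondegenerate_triangle A B C)
    (a b c : R) (ha : a = edist B C) (hb : b = edist C A) (hc : c = edist A B)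
    (x y z : R) (hxyz : x + y + z != 0)
    (P : point R)
    (hP : P = bary A B C ((x + y + z)^-1 * x) ((x + y + z)^-1 * y)
                         ((x + y + z)^-1 * z))
    (Q : point R) :
  (x + y + z) * (x * edist Q A ^+ 2 + y * edist Q B ^+ 2 + z * edist Q C ^+ 2)
    - (y * z * a ^+ 2 + z * x * b ^+ 2 + x * y * c ^+ 2)
    = (x + y + z) ^+ 2 * edist P Q ^+ 2
  /\ 0 <= (x + y + z) ^+ 2 * edist P Q ^+ 2.
Proof.
split; last by rewrite mulr_ge0 ?sqr_ge0.
rewrite ha hb hc hP !edist_sqr !big_ord_recl !big_ord0 !mxE.
(* The only denominator is [x + y + z], coming from the normalization of [P]; [hxyz] discharges the
   side condition. *)
by field.
Qed.
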